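(* The class $\mathcal{LO}_{sp}$ of linearly ordered sets equipped with one strict order preserving unary operation has the amalgamation property but does not have the strong amalgamation property.
   Context: A unary operation $f$ on an ordered set is strict order preserving if $a<b$ implies $f(a)<f(b)$. Embeddings are injective maps commuting with the operation and satisfying $c\le d\iff \iota(c)\le\iota(d)$. A class $\mathcal K$ has the amalgamation property (AP) if whenever $\mathbf A,\mathbf B,\mathbf C\in\mathcal K$ and $\iota_1:\mathbf C\to\mathbf A$, $\iota_2:\mathbf C\to\mathbf B$ are embeddings, there exist $\mathbf D\in\mathcal K$ and embeddings $j_1:\mathbf A\to\mathbf D$, $j_2:\mathbf B\to\mathbf D$ with $j_1\circ\iota_1=j_2\circ\iota_2$; it has the strong amalgamation property (SAP) if moreover these can always be chosen with $j_1(A)\cap j_2(B)=j_1(\iota_1(C))$. *)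

(* Defs.v *)
From mathcomp Require Import all_boot all_order.
From mathcomp Require Import classical_sets.

Set Implicit Arguments.
Unset Strict Implicit.
Unset Printing Implicit Defensive.

Local Open Scope order_scope.
Local Open Scope classical_set_scope.

(* The carrier may be empty, and the operation is subject to no condition; the
   display is only the notational tag that MathComp attaches to an order. *)
Record uposet := UPoset {
  uposet_disp : Order.disp_t;
  uposet_sort :> porderType uposet_disp;
  uop : uposet_sort -> uposet_sort }.

Arguments uop : clear implicits.

Definition strict_order_preserving (A : uposet) : Prop :=
  {homo uop A : a b / a < b}.

Definition LOsp (A : uposet) : Prop :=
  total (<=%O : rel A) /\ strict_order_preserving A.

Definition embedding (C D : uposet) (i : C -> D) : Prop :=
  [/\ injective i,
      forall c : C, i (uop C c) = uop D (i c)
    & forall c d : C, c <= d <-> i c <= i d].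

Definition amalgam (C A B D : uposet) (i1 : C -> A) (i2 : C -> B)
    (j1 : A -> D) (j2 : B -> D) : Prop :=
  [/\ embedding j1, embedding j2 & j1 \o i1 =1 j2 \o i2].

Definition AP (K : uposet -> Prop) : Prop :=
  forall (A B C : uposet) (i1 : C -> A) (i2 : C -> B),
    K A -> K B -> K C -> embedding i1 -> embedding i2 ->
    exists (D : uposet) (j1 : A -> D) (j2 : B -> D),
      K D /\ amalgam i1 i2 j1 j2.

Definition SAP (K : uposet -> Prop) : Prop :=
  forall (A B C : uposet) (i1 : C -> A) (i2 : C -> B),
    K A -> K B -> K C -> embedding i1 -> embedding i2 ->
    exists (D : uposet) (j1 : A -> D) (j2 : B -> D),
      [/\ K D, amalgam i1 i2 j1 j2
        & range j1 `&` range j2 = j1 @` range i1].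

(* Main.v *)
Require Import Defs.
From HB Require Import structures.
From mathcomp Require Import all_boot all_order.
From mathcomp Require Import boolp classical_sets.

Set Implicit Arguments.
Unset Strict Implicit.
Unset Printing Implicit Defensive.

Import Order.TTheory.
Local Open Scope order_scope.
Local Open Scope classical_set_scope.
Local Open Scope quotient_scope.

(** For amalgamation, think of [A], [B] and [C] as extended by formal inverse
    iterates of their (injective) operations, so that the operation becomes
    bijective.  Each element of [A] or [B] then fills a cut of the extended
    [C], the operation permutes these cuts, and inside each cut the elements
    of [A] are put below those of [B].  The inverse iterates are only used
    implicitly: a comparison is allowed to take place after applying a common
    iterate of the operations.

    Strong amalgamation fails for [C = A = B] the natural numbers with
    successor, embedded by the successor: the two zeros have the same successor
    in any amalgam, hence are identified, but they do not come from [C]. *)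

(** Identifying mutually comparable points makes the preorder a linear order. Since [f] preserves
    and reflects [r], it descends to the quotient, and there it preserves strictness as well. *)
Lemma total_preorder_quotient (T : choiceType) (r : rel T) (f : T -> T) :
  reflexive r -> transitive r -> total r ->
  (forall x y, r (f x) (f y) = r x y) ->
  exists (D : uposet) (p : T -> D),
    [/\ LOsp D, forall x, p (f x) = uop D (p x)
      & forall x y, (p x <= p y) = r x y].
Proof.
move=> r_refl r_trans r_total r_f.
pose e := [rel x y | r x y && r y x].
have e_refl : reflexive e by move=> x; rewrite /= r_refl.
have e_sym : symmetric e by move=> x y; rewrite /= andbC.
have e_trans : transitive e.
  move=> y x z /= /andP[xy yx] /andP[yz zy].
  by rewrite (r_trans _ _ _ xy yz) (r_trans _ _ _ zy yx).
pose eR := EquivRel e e_refl e_sym e_trans.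
pose Q := {eq_quot eR}.
pose p : T -> Q := fun x => \pi_Q x.
pose le : rel Q := fun x y => r (repr x) (repr y).
have piP x y : reflect (p x = p y) (e x y) by apply: (@eqmodP _ eR).
have e_repr x : e (repr (p x)) x by apply/piP; rewrite /p reprK.
have leE x y : le (p x) (p y) = r x y.
  rewrite /le; have /andP[xl xr] := e_repr x; have /andP[yl yr] := e_repr y.
  apply/idP/idP => xy; first exact: r_trans xr (r_trans _ _ _ xy yl).
  exact: r_trans xl (r_trans _ _ _ xy yr).
have le_refl : reflexive le by move=> x; apply: r_refl.
have le_anti : antisymmetric le.
  by move=> x y xy; rewrite -[x]reprK -[y]reprK; apply/piP.
have le_trans : transitive le by move=> y x z; apply: r_trans.
pose d := Order.Disp tt tt.
pose Dt : porderType d := HB.pack_for (porderType d) Q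
  (Order.Le_isPOrder.Build d Q le_refl le_anti le_trans).
pose D := @UPoset d Dt (fun x : Q => p (f (repr x))).
exists D, p; split => [|x|//]; last first.
  by apply/piP; have /andP[xl xr] := e_repr x; rewrite /= !r_f xl xr.
split=> [x y|x y]; first exact: r_total.
rewrite !lt_leAnge => /andP[xy yx]; apply/andP.
by split; rewrite [_ <= _]leE r_f.
Qed.

(** By totality, if [x <= y] fails then [y < x], and strictness carries this to the images. *)
Lemma LOsp_leE (A : uposet) : LOsp A -> {mono uop A : x y / x <= y}.
Proof.
move=> [tot sp] x y; apply/idP/idP => [|xy].
  apply: contraTT => nxy; have yx : y <= x by have := tot x y; rewrite (negPf nxy).
  have /sp : y < x by rewrite lt_leAnge yx nxy.
  by rewrite lt_leAnge => /andP[].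
by move: xy; rewrite le_eqVlt => /predU1P[->//|/sp/ltW].
Qed.

Lemma LOsp_iter_leE (A : uposet) n :
  LOsp A -> {mono iter n (uop A) : x y / x <= y}.
Proof. by move=> /LOsp_leE fA x y; elim: n => //= n <-; rewrite fA. Qed.

Lemma LOsp_iter_inj (A : uposet) n : LOsp A -> injective (iter n (uop A)).
Proof. by move=> lA; exact: inc_inj (LOsp_iter_leE n lA). Qed.

Lemma embedding_iter (C A : uposet) (i : C -> A) n c :
  embedding i -> i (iter n (uop C) c) = iter n (uop A) (i c).
Proof. by move=> [_ iu _]; elim: n => //= n <-. Qed.

Lemma LOsp_AP : AP LOsp.
Proof.
move=> A B C i1 i2 lA lB lC e1 e2.
have totA := lA.1; have totB := lB.1.
have le1 c d : (i1 c <= i1 d) = (c <= d).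
  by case: e1 => _ _ h; apply/idP/idP => /h.
have le2 c d : (i2 c <= i2 d) = (c <= d).
  by case: e2 => _ _ h; apply/idP/idP => /h.
pose fA n := iter n (uop A); pose fB n := iter n (uop B).
(* [L b a]: after [n] steps, some point of [C] separates [b] from [a] weakly. [E a b]: after [n]
   steps, both are the same point of [C]. Letting [n] vary is what makes the operation reflect these
   relations: [a] may enter the image of [C] only after some steps. *)
pose L b a := exists n c, fB n b <= i2 c /\ i1 c <= fA n a.
pose E a b := exists n c, fA n a = i1 c /\ fB n b = i2 c.
have L_shift m n b a c : fB n b <= i2 c -> i1 c <= fA n a ->
    fB (m + n)%N b <= i2 (iter m (uop C) c) /\
    i1 (iter m (uop C) c) <= fA (m + n)%N a.
  by move=> bc ca; rewrite !embedding_iter // /fA /fB !iterD !LOsp_iter_leE.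
have E_shift m n b a c : fA n a = i1 c -> fB n b = i2 c ->
    fA (m + n)%N a = i1 (iter m (uop C) c) /\
    fB (m + n)%N b = i2 (iter m (uop C) c).
  by move=> ac bc; rewrite !embedding_iter // /fA /fB !iterD -ac -bc.
have LfE b a : L (uop B b) (uop A a) <-> L b a.
  split=> [[n [c]]|[n [c [bc ca]]]].
    by rewrite /fA /fB -!iterSr; exists n.+1, c.
  have := L_shift 1%N _ _ _ _ bc ca; rewrite add1n /fA /fB !iterSr => h.
  by exists n, (uop C c).
have EfE a b : E (uop A a) (uop B b) <-> E a b.
  split=> [[n [c]]|[n [c [bc ca]]]].
    by rewrite /fA /fB -!iterSr; exists n.+1, c.
  have := E_shift 1%N _ _ _ _ bc ca; rewrite add1n /fA /fB !iterSr => h.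
  by exists n, (uop C c).
have L_mono b b' a a' : b' <= b -> a <= a' -> L b a -> L b' a'.
  move=> bb aa [n [c [bc ca]]]; exists n, c.
  by split; [apply: le_trans bc|apply: (le_trans ca)]; rewrite LOsp_iter_leE.
have EL a b : E a b -> L b a.
  by move=> [n [c [ac bc]]]; exists n, c; rewrite ac bc.
(* Witnesses with exponents [n] and [m] are both shifted to [m + n], so that their points of [C] can
   be compared. *)
have E_common a b a' b' : E a b -> L b' a' ->
    exists n c d, [/\ fA n a = i1 c, fB n b = i2 c,
      fB n b' <= i2 d & i1 d <= fA n a'].
  move=> [n [c [ac bc]]] [m [d [bd da]]].
  have [ac' bc'] := E_shift m _ _ _ _ ac bc.
  have [bd' da'] := L_shift n _ _ _ _ bd da.
  exists (m + n)%N, (iter m (uop C) c), (iter n (uop C) d).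
  by split=> //; rewrite addnC.
(* Without a separating point of [C], [a] goes below [b]; the disjunct [E a b] also gives [a] below
   [b] when the two must be identified. *)
pose r (x y : A + B) : bool := match x, y with
  | inl a, inl a' => a <= a'
  | inr b, inr b' => b <= b'
  | inr b, inl a => `[< L b a >]
  | inl a, inr b => `[< ~ L b a \/ E a b >]
  end.
have r_refl : reflexive r by case=> x; apply: lexx.
have r_total : total r.
  case=> [a|b] [a'|b']; rewrite /r; try by [apply: totA|apply: totB].
    by have [h|h] := pselect (L b' a); apply/orP; [right|left]; apply/asboolP; auto.
  by have [h|h] := pselect (L b a'); apply/orP; [left|right]; apply/asboolP; auto.
have r_trans : transitive r.
  case=> [a2|b2] [a1|b1] [a3|b3]; rewrite /r.
  - exact: le_trans.
  - move=> aa /asboolP ab; apply/asboolP.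
    (* If [L b3 a1], then [L b3 a2] by monotonicity, so [E a2 b3] must hold. At a common exponent
       this squeezes [a1] between equal points of [C], whence [E a1 b3]. *)
    have [h|] := pselect (L b3 a1); last by left.
    case: ab => [[]|/E_common/(_ h)]; first exact: L_mono h.
    move=> [n [c [d [ac bc bd da]]]]; right; exists n, c; split=> //.
    apply/le_anti; rewrite -{1}ac LOsp_iter_leE // aa /=.
    by apply: le_trans da; rewrite le1 -le2 -bc.
  - move=> /asboolP ba aa; apply/asboolP; exact: L_mono ba.
  - move=> /asboolP ba /asboolP[nL|/E_common/(_ ba)].
      have := totB b1 b3; case/orP => // bb; case: nL; exact: L_mono ba.
    move=> [n [c [d [ac bc bd da]]]]; rewrite -(LOsp_iter_leE n lB).
    by rewrite -/(fB n b3) bc (le_trans bd) // le2 -le1 -ac.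
  - move=> /asboolP ab /asboolP ba.
    case: ab => [nL|/E_common/(_ ba)].
      have := totA a1 a3; case/orP => // aa; case: nL; exact: L_mono ba.
    move=> [n [c [d [ac bc bd da]]]]; rewrite -(LOsp_iter_leE n lA).
    by rewrite -/(fA n a1) ac; apply: le_trans da; rewrite le1 -le2 -bc.
  - move=> /asboolP ab bb; apply/asboolP.
    have [h|] := pselect (L b3 a1); last by left.
    case: ab => [[]|/E_common/(_ h)]; first exact: L_mono h.
    move=> [n [c [d [ac bc bd da]]]]; right; exists n, c; split=> //.
    apply/le_anti; rewrite -{2}bc LOsp_iter_leE // bb andbT.
    by apply: (le_trans bd); rewrite le2 -le1 -ac.
  - move=> bb /asboolP ba; apply/asboolP; exact: L_mono ba.
  - exact: le_trans.
pose f (x : A + B) : A + B :=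
  match x with inl a => inl (uop A a) | inr b => inr (uop B b) end.
have r_f x y : r (f x) (f y) = r x y.
  case: x y => [a|b] [a'|b'] /=; rewrite ?LOsp_leE //.
    by apply: asbool_equiv_eq; rewrite LfE EfE.
  by apply: asbool_equiv_eq; rewrite LfE.
have [D [p [lD pf pE]]] := total_preorder_quotient r_refl r_trans r_total r_f.
have emb (X : uposet) (j : X -> A + B) : (forall x, j (uop X x) = f (j x)) ->
    (forall x y, r (j x) (j y) = (x <= y)) -> embedding (p \o j).
  move=> jf jr; have pj : {mono p \o j : x y / x <= y} by move=> x y /=; rewrite pE.
  by split=> [|x|x y]; [exact: inc_inj pj|rewrite /= jf pf|rewrite pj].
exists D, (p \o inl), (p \o inr); split=> //; split; try exact: emb.
(* Exponent 0 gives [E], hence also [L]: the two copies of [c] are comparable both ways and merge in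
   the quotient. *)
move=> c /=; have h : E (i1 c) (i2 c) by exists 0%N, c.
by apply/le_anti; rewrite !pE /r; apply/andP; split; apply/asboolP; auto.
Qed.

Lemma LOsp_not_SAP : ~ SAP LOsp.
Proof.
pose N := @UPoset _ (nat : porderType _) succn.
have lN : LOsp N by split=> [x y|x y //]; apply: leq_total.
have eS : @embedding N N succn by split=> // x y; apply: succn_inj.
move=> /(_ N N N succn succn lN lN lN eS eS).
move=> [D [j1 [j2 [lD [[j1_inj j1u _] [_ j2u _] j12] jI]]]].
have j0 : j1 0%N = j2 0%N.
  apply: (LOsp_iter_inj (n := 1) lD); rewrite /= -j1u -j2u; exact: j12.
have : (range j1 `&` range j2) (j1 0%N).
  by split; [exists 0%N|exists 0%N].
(* Otherwise [j1] would take equal values at 0 and at some successor. *)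
by rewrite jI => -[_ [k _ <-]] /j1_inj.
Qed.

Theorem theorem3p1 : AP LOsp /\ ~ SAP LOsp.
Proof. by split; [apply: LOsp_AP|apply: LOsp_not_SAP]. Qed.
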